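(* Let $f\in\Gamma_0(\mathbb{R}^n)$ achieve its minimum $\min f$ and let $\lambda>0$. Let $\epsilon>0$ be a fixed constant and set $\Omega=\{x:f(x)\le\min f+\epsilon\}\cap\mathrm{dom}\,\partial f$. Starting from $x_0\in\Omega$, the proximal point algorithm (PPA) is defined by $$x_{k+1}=\mathbf{prox}_{\lambda f}(x_k)=x_k-\lambda\nabla f_\lambda(x_k),\quad k\ge0.$$ (i) If $f$ satisfies the $(f,\alpha,\Omega)$-(obj-EB) condition, then $f_\lambda$ satisfies the $(\nabla f_\lambda,\nu,\Omega)$-(cor-EB) condition with $\nu=\min\{\frac\alpha4,\frac1{4\lambda}\}$, and hence the PPA converges linearly in the sense that $$d^2(x_{k+1},\mathrm{Arg}\min f)\le\left(1-\min\left\{\frac{\alpha\lambda}{4},\frac14\right\}\right)d^2(x_k,\mathrm{Arg}\min f),\quad k\ge0.$$ (ii) Conversely, if, starting from an arbitrary initial point $x_0\in\Omega$, the PPA converges linearly in the sense that $d^2(x_{k+1},\mathrm{Arg}\min f)\le\tau\, d^2(x_k,\mathrm{Arg}\min f)$ for all $k\ge0$ with a constant $\tau\in(0,1)$, then $f$ satisfies the $(f,\alpha,\Omega)$-(obj-EB) condition with $\alpha=\frac{(1-\sqrt\tau)^2}{2\lambda}$.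
   Context: $\Gamma_0(\mathbb{R}^n)$ is the class of proper lower semicontinuous convex functions $\mathbb{R}^n\to(-\infty,+\infty]$; $\mathrm{dom}\,f=\{x:f(x)<+\infty\}$; $\partial f$ is the convex subdifferential and $\mathrm{dom}\,\partial f=\{x:\partial f(x)\ne\emptyset\}$; $\mathrm{crit}\,f=\{x:0\in\partial f(x)\}=\mathrm{Arg}\min f$ (the set of minimizers). $d(x,Q)=\inf_{y\in Q}\|x-y\|$. $\mathbf{prox}_{\lambda f}(x)=\arg\min_{y}\{f(y)+\frac1{2\lambda}\|y-x\|^2\}$, and $f_\lambda(x)=\min_{u}\{f(u)+\frac1{2\lambda}\|x-u\|^2\}$ is the Moreau–Yosida regularization; it is real-valued, convex, continuously differentiable with $\nabla f_\lambda(x)=\lambda^{-1}(x-\mathbf{prox}_{\lambda f}(x))$, and $\mathrm{Arg}\min f_\lambda=\mathrm{Arg}\min f$, $\min f_\lambda=\min f$. Conditions (with positive constants): - $(f,\alpha,\Omega)$-(obj-EB): $f(x)-\min f\ge\frac\alpha2d^2(x,\mathrm{crit}\,f)$ for all $x\in\Omega\cap\mathrm{dom}\,f$; - $(\nabla f_\lambda,\nu,\Omega)$-(cor-EB) for $f_\lambda$: $\inf_{x_p\in\mathcal{P}_{f_\lambda}(x)}\langle\nabla f_\lambda(x),x-x_p\rangle\ge\nu\,d^2(x,\mathrm{crit}\,f_\lambda)$ for all $x\in\Omega$, where $\mathrm{crit}\,f_\lambda=\{x:\nabla f_\lambda(x)=0\}$ and $\mathcal{P}_{f_\lambda}(x)$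 is the set of points of $\mathrm{crit}\,f_\lambda$ nearest to $x$. *)

(* Defs.v *)
From HB Require Import structures.
From mathcomp Require Import all_boot all_order all_algebra.
From mathcomp Require Import all_classical all_reals all_analysis.

Set Implicit Arguments.
Unset Strict Implicit.
Unset Printing Implicit Defensive.

Import Order.TTheory GRing.Theory Num.Theory.
Import numFieldNormedType.Exports.

Local Open Scope classical_set_scope.
Local Open Scope ring_scope.

Section Euclidean.
Context {R : realType} {n : nat}.
Implicit Types (x y : 'rV[R]_n) (Q : set 'rV[R]_n).

Definition dot x y : R := (x *m y^T) 0 0.

(* The library norm on ['rV_n] is the sup norm; distances here are Euclidean. *)
Definition enorm x : R := Num.sqrt (dot x x).

Definition dist_set x Q : R := inf [set enorm (x - y) | y in Q].

Definition nearest Q x : set 'rV[R]_n :=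
  [set p | Q p /\ enorm (x - p) = dist_set x Q].

(* The vector of partial derivatives. *)
Definition gradient (g : 'rV[R]_n -> R) x : 'rV[R]_n :=
  \row_(j < n) 'D_(delta_mx 0 j) g x.

Definition crit_grad (g : 'rV[R]_n -> R) : set 'rV[R]_n :=
  [set x | gradient g x = 0].

End Euclidean.

Section ConvexAnalysis.
Context {R : realType} {n : nat}.
Implicit Types (f : 'rV[R]_n -> \bar R) (x y : 'rV[R]_n) (lam : R).

Local Open Scope ereal_scope.

Definition dom f : set 'rV[R]_n := [set x | f x < +oo].

Definition proper f := (forall x, f x != -oo) /\ dom f !=set0.

Definition econvex f := forall x y (t : R), (0 < t < 1)%R ->
  f (t *: x + (1 - t) *: y)%R <= t%:E * f x + (1 - t)%:E * f y.

Definition Gamma0 f := [/\ proper f, lower_semicontinuous f & econvex f].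

(* For proper [f] this is empty wherever [f x = +oo]. *)
Definition subdiff f x : set 'rV[R]_n :=
  [set v | forall y, f x + (dot v (y - x))%:E <= f y].

Definition dom_subdiff f : set 'rV[R]_n := [set x | subdiff f x !=set0].

Definition crit f : set 'rV[R]_n := [set x | subdiff f x 0%R].

Definition Argmin f : set 'rV[R]_n := [set x | forall y, f x <= f y].

(* The infimum of [f]; it is the minimum when [Argmin f] is nonempty. *)
Definition minval f : \bar R := ereal_inf (range f).

Definition prox_obj lam f x : 'rV[R]_n -> \bar R :=
  fun u => f u + (enorm (x - u) ^+ 2 / (2 * lam))%:E.

(* For [f] in [Gamma0] and [0 < lam] the set of minimizers is a singleton, so
   the default value [0] of [xget] is never used. *)
Definition prox lam f x : 'rV[R]_n := xget 0%R (Argmin (prox_obj lam f x)).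

(* For [f] in [Gamma0] and [0 < lam] the infimum is attained and finite, so
   [fine] loses nothing. *)
Definition moreau lam f x : R := fine (minval (prox_obj lam f x)).

Definition PPA lam f (x0 : 'rV[R]_n) (k : nat) : 'rV[R]_n :=
  iter k (prox lam f) x0.

Definition obj_EB f (alpha : R) (Omega : set 'rV[R]_n) : Prop :=
  (0 < alpha)%R /\
  forall x, (Omega `&` dom f) x ->
    (alpha / 2 * dist_set x (crit f) ^+ 2)%:E <= f x - minval f.

Definition cor_EB (g : 'rV[R]_n -> R) (nu : R) (Omega : set 'rV[R]_n) : Prop :=
  (0 < nu)%R /\
  forall x, Omega x ->
    (nu * dist_set x (crit_grad g) ^+ 2)%:E <=
    ereal_inf [set (dot (gradient g x) (x - p))%:E
              | p in nearest (crit_grad g) x].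

Definition sublevel_region f (eps : R) : set 'rV[R]_n :=
  [set x | f x <= minval f + eps%:E] `&` dom_subdiff f.

End ConvexAnalysis.

(* Main.v *)
Require Import Defs.
From mathcomp Require Import all_boot all_order all_algebra.
From mathcomp Require Import all_classical all_reals all_analysis.
From mathcomp Require Import ring lra.

Import Order.TTheory GRing.Theory Num.Theory.
Import numFieldNormedType.Exports.

Local Open Scope classical_set_scope.
Local Open Scope ring_scope.

(** Write [C] for the set of minimizers of [f], [m] for its minimum, and
[q = prox x].  The proof rests on the optimality condition of the proximal
subproblem, [(x - q) / lam] is a subgradient of [f] at [q] ([prox_subdiff]):
for every [y], [f q + <x - q, y - q> / lam <= f y].

It identifies the envelope.  Testing the minimum that defines the envelope at
[x + h] with [prox x], and the one at [x] with [prox (x + h)], and using that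
[prox] is firmly nonexpansive ([prox_firm]), the envelope differs from its
linearization of slope [(x - q) / lam] by at most [|h|^2 / (2 lam)]
([moreau_expansion]).  So its gradient is [(x - q) / lam], a proximal step is
a gradient step of length [lam], and the critical points of the envelope are
the fixed points of [prox], that is, [C].

Part (i).  Taking [y = c] in [C] gives [f q - m <= <x - q, q - c> / lam], and
the growth condition at [q], which stays in the region because
[f q <= f x], turns this into [alpha/2 d(q)^2 <= <x - q, q - c> / lam]
([prox_dist_le_gap]).  Expanding [x - c = (x - q) + (q - c)] in [<x - q, x - c>]
or in [|x - c|^2] bounds these from below by a combination of [|x - q|^2] and
[d(q)^2], and [d(x)^2 <= 2 |x - q|^2 + 2 d(q)^2] converts that into a multiple
of [d(x)^2]; the factor 4 in the constants is the loss in this last step.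

Part (ii).  Taking [y = x] gives the descent [f x - f q >= |x - q|^2 / lam].
If one step contracts, [d(q) <= sqrt tau d(x)], the triangle inequality
[d(x) <= |x - q| + d(q)] forces [|x - q| >= (1 - sqrt tau) d(x)], hence the
growth of [f] at [x]. *)

(** * Euclidean norm and distance to a set *)

Section EuclideanSpace.
Context {R : realType} {n : nat}.
Implicit Types (a b c x y p : 'rV[R]_n) (Q : set 'rV[R]_n).

Lemma dotE x y : dot x y = \sum_j x 0 j * y 0 j.
Proof. by rewrite /dot mxE; apply: eq_bigr => j _; rewrite mxE. Qed.

Lemma dotC x y : dot x y = dot y x.
Proof. by rewrite !dotE; apply: eq_bigr => j _; rewrite mulrC. Qed.

Lemma dotDl x y p : dot (x + y) p = dot x p + dot y p.
Proof. by rewrite /dot mulmxDl mxE. Qed.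

Lemma dotZl (t : R) x y : dot (t *: x) y = t * dot x y.
Proof. by rewrite /dot -scalemxAl mxE. Qed.

Lemma dotNl x y : dot (- x) y = - dot x y.
Proof. by rewrite -scaleN1r dotZl mulN1r. Qed.

Lemma dotDr x y p : dot x (y + p) = dot x y + dot x p.
Proof. by rewrite dotC dotDl !(dotC _ x). Qed.

Lemma dotZr (t : R) x y : dot x (t *: y) = t * dot x y.
Proof. by rewrite dotC dotZl dotC. Qed.

Lemma dotNr x y : dot x (- y) = - dot x y.
Proof. by rewrite dotC dotNl dotC. Qed.

Definition dot_linear := (dotDl, dotDr, dotNl, dotNr, dotZl, dotZr).

Lemma dot0l x : dot 0 x = 0.
Proof. by rewrite -(scale0r 0) dotZl mul0r. Qed.

Lemma dot_delta (j : 'I_n) x : dot (delta_mx 0 j) x = x 0 j.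
Proof.
rewrite dotE (bigD1 j) //= big1 ?addr0 ?mxE ?eqxx ?mul1r // => i ij.
by rewrite mxE eqxx (negbTE ij) mul0r.
Qed.

Lemma dot_ge0 x : 0 <= dot x x.
Proof. by rewrite dotE sumr_ge0 // => j _; rewrite -expr2 sqr_ge0. Qed.

Lemma dot_eq0 x : dot x x = 0 -> x = 0.
Proof.
rewrite dotE => /eqP; rewrite psumr_eq0; last first.
  by move=> j _; rewrite -expr2 sqr_ge0.
move=> /allP x0; apply/rowP => j; rewrite mxE; apply/eqP.
by have := x0 j (mem_index_enum j); rewrite /= mulf_eq0 orbb.
Qed.

Lemma enorm_ge0 x : 0 <= enorm x.
Proof. exact: sqrtr_ge0. Qed.

Lemma enorm2 x : enorm x ^+ 2 = dot x x.
Proof. by rewrite sqr_sqrtr ?dot_ge0. Qed.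

(** Links the Euclidean norm to the product topology: Euclidean balls lie in
boxes, which are compact. *)
Lemma coord_le_enorm x (j : 'I_n) : `|x 0 j| <= enorm x.
Proof.
rewrite -sqrtr_sqr ler_wsqrtr // dotE (bigD1 j) //= -expr2 lerDl.
by apply: sumr_ge0 => i _; rewrite -expr2 sqr_ge0.
Qed.

Lemma cauchy_schwarz x y : dot x y ^+ 2 <= dot x x * dot y y.
Proof.
have [y0|ygt0] := eqVneq (dot y y) 0.
  by rewrite (dot_eq0 _ y0) dotC !dot0l expr0n mulr0.
have yy : 0 < dot y y by rewrite lt_def ygt0 dot_ge0.
(* This vector is [dot y y] times the component of [x] orthogonal to [y]. *)
have := dot_ge0 (dot y y *: x - dot x y *: y).
rewrite !dot_linear (dotC y x) => h.
rewrite -subr_ge0 -(pmulr_rge0 _ yy); move: h; congr (_ <= _); ring.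
Qed.

Lemma enormD x y : enorm (x + y) <= enorm x + enorm y.
Proof.
rewrite -ler_sqr ?nnegrE ?addr_ge0 ?enorm_ge0 // sqrrD !enorm2 !dot_linear.
rewrite (dotC y x) -subr_ge0.
have dot_le : dot x y <= enorm x * enorm y.
  apply: le_trans (ler_norm _) _.
  rewrite -ler_sqr ?nnegrE ?normr_ge0 ?mulr_ge0 ?enorm_ge0 //.
  by rewrite exprMn !enorm2 real_normK ?num_real // cauchy_schwarz.
rewrite mulr2n; lra.
Qed.

Lemma dot_self_continuous x : continuous (fun u : 'rV[R]_n => dot (x - u) (x - u)).
Proof.
rewrite (_ : (fun u => _) =
    fun u : 'rV[R]_n => \sum_j (x 0 j - u 0 j) * (x 0 j - u 0 j)); last first.
  by apply/funext => u; rewrite dotE; apply: eq_bigr => j _; rewrite !mxE.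
apply: continuous_big => [|j _]; first exact: add_continuous.
have coord_cont : continuous (fun u : 'rV[R]_n => x 0 j - u 0 j).
  move=> u; apply: (@continuousB _ R^o _ (fun=> x 0 j) (fun v : 'rV[R]_n => v 0 j)).
    exact: cst_continuous.
  exact: (@coord_continuous R 1 n 0 j).
by move=> u; have := continuousM (coord_cont u) (coord_cont u).
Qed.

Lemma dist_set_ge0 x Q : Q !=set0 -> 0 <= dist_set x Q.
Proof.
move=> [q Qq]; apply: lb_le_inf; first by exists (enorm (x - q)), q.
by move=> _ [p _ <-]; exact: enorm_ge0.
Qed.

Lemma dist_set_le x Q c : Q c -> dist_set x Q <= enorm (x - c).
Proof.
move=> Qc; apply: ge_inf; last by exists c.
by exists 0 => _ [p _ <-]; exact: enorm_ge0.
Qed.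

Lemma dist_set_triangle x y Q : Q !=set0 ->
  dist_set x Q <= enorm (x - y) + dist_set y Q.
Proof.
move=> [q Qq]; rewrite -lerBlDl; apply: lb_le_inf; first by exists (enorm (y - q)), q.
move=> _ [c Qc <-]; rewrite lerBlDl.
apply: le_trans (dist_set_le _ _ _ Qc) _.
by rewrite -{1}(subrK y x) -addrA enormD.
Qed.

Lemma sqr_dist_set_split x y Q : Q !=set0 ->
  dist_set x Q ^+ 2 <= 2 * dot (x - y) (x - y) + 2 * dist_set y Q ^+ 2.
Proof.
move=> Q0; have := dist_set_triangle x y _ Q0; rewrite -enorm2.
have := dist_set_ge0 x _ Q0; have := enorm_ge0 (x - y).
have := dist_set_ge0 y _ Q0.
move: (dist_set y _) (dist_set x _) (enorm _) => d e r d0 r0 e0 der.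
have : e ^+ 2 <= (r + d) ^+ 2 by rewrite ler_sqr ?nnegrE ?addr_ge0.
have := sqr_ge0 (r - d); nra.
Qed.

(** Spares the choice of a nearest point, which exists only for suitable [Q]:
a bound on the squared distances to all points of [Q] passes to the infimum. *)
Lemma le_sqr_dist_set x Q (m : R) : Q !=set0 ->
  (forall c, Q c -> m <= dot (x - c) (x - c)) -> m <= dist_set x Q ^+ 2.
Proof.
move=> Q0 mQ; have [m0|/ltW m0] := leP 0 m; last first.
  exact: le_trans m0 (sqr_ge0 _).
rewrite -(sqr_sqrtr m0) ler_sqr ?nnegrE ?sqrtr_ge0 ?dist_set_ge0 //.
have [q Qq] := Q0; apply: lb_le_inf; first by exists (enorm (x - q)), q.
by move=> _ [c Qc <-]; rewrite ler_wsqrtr // mQ.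
Qed.

End EuclideanSpace.

(** * Attainment of minima by lower semicontinuous functions *)

Section Semicontinuity.
Local Open Scope ereal_scope.

(** The strict sublevel sets above the infimum generate a proper filter on
[K]; at a cluster point of it, semicontinuity keeps the value from exceeding the
infimum. *)
Lemma lsc_attains_min (T : topologicalType) (R : realType) (g : T -> \bar R)
    (K : set T) : lower_semicontinuous g -> compact K -> K !=set0 ->
  exists2 p, K p & forall u, K u -> g p <= g u.
Proof.
move=> g_lsc K_compact [k Kk]; set i := ereal_inf [set g u | u in K].
have i_le u : K u -> i <= g u by move=> Ku; apply: ereal_inf_lbound; exists u.
(* If the infimum is [+oo] no sublevel set lies strictly above it, but then
   every point of [K] is a minimizer. *)
have [ioo|i_lt] := eqVneq i +oo.
  exists k => // u Ku; have := i_le u Ku; rewrite ioo leye_eq => /eqP ->.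
  exact: leey.
have low_filter : ProperFilter (filter_from [set a | i < a]
    (fun a => [set u | K u /\ g u < a])).
  apply: filter_from_proper; last first.
    by move=> a /ereal_inf_ltP[_ [u Ku <-] ga]; exists u.
  apply: filter_from_filter; first by exists +oo; rewrite /= ltey.
  move=> a b ia ib; exists (Order.min a b); first by rewrite /= lt_min ia ib.
  by move=> u [Ku]; rewrite lt_min => /andP[].
have [|p [Kp p_cluster]] := K_compact _ low_filter.
  by exists +oo => [|u []//]; rewrite /= ltey.
exists p => // u Ku; apply: le_trans (i_le u Ku).
rewrite leNgt; apply/negP => i_lt_gp.
have [a /andP[ia ap]] : exists a : R, i < a%:E < g p.
  case: i (g p) i_lt_gp {i_le i_lt low_filter p_cluster} => [r| |] [s| |] //= rs.
  - by exists ((r + s) / 2)%R; move: rs; rewrite !lte_fin => rs; lra.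
  - by exists (r + 1)%R; rewrite ltry lte_fin ltrDl ltr01.
  - by exists (s - 1)%R; rewrite ltNyr lte_fin gtrDl oppr_lt0 ltr01.
  - by exists 0%R; rewrite ltNyr ltry.
have [V Vp gV] := g_lsc p a ap.
have [|v [[_ va] Vv]] := p_cluster [set u | K u /\ g u < a%:E] V _ Vp.
  by exists a%:E.
by have := lt_trans (gV v Vv) va; rewrite ltxx.
Qed.

Lemma lscD_continuous (T : topologicalType) (R : realType) (g : T -> \bar R)
    (h : T -> R) : lower_semicontinuous g -> continuous h ->
  lower_semicontinuous (fun u => g u + (h u)%:E).
Proof.
move=> g_lsc h_cont u a au.
(* Split the slack between the two summands. *)
have [b [bg abh]] : exists b : R, b%:E < g u /\ (a - b < h u)%R.
  move: au; case: (g u) => [r| |] // au.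
  - exists ((r + a - h u) / 2)%R; move: au; rewrite -EFinD !lte_fin; split; lra.
  - by exists (a - h u + 1)%R; rewrite ltry; split=> //; lra.
have [V Vu gV] := g_lsc u b bg.
exists (V `&` [set v | a - b < h v]%R).
  by apply: filterI => //; apply: (cvgr_gt (h u)) => //; exact: h_cont.
move=> v [Vv hv]; rewrite -(subrK b a) addrC EFinD.
by apply: lteD; [exact: gV|rewrite lte_fin].
Qed.
End Semicontinuity.

(** * Limiting arguments *)

Lemma le_of_le_scaled_error (R : realType) (a b C : R) : 0 <= C ->
  (forall t : R, 0 < t < 1 -> a <= b + t * C) -> a <= b.
Proof.
move=> C0 ab; apply/ler_addgt0Pr => e e0.
have Ce : 0 < C + e + 1 by lra.
have t01 : 0 < e / (C + e + 1) < 1.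
  by rewrite divr_gt0 //= ltr_pdivrMr // mul1r; lra.
apply: le_trans (ab _ t01) _; rewrite lerD2l mulrAC ler_pdivrMr //.
by rewrite ler_wpM2l ?ltW //; lra.
Qed.

Section Calculus.
Context {R : realType} {n : nat}.

(** Along a coordinate direction the difference quotient at step [h] is
within [C * |h|] of the corresponding coordinate of [w]. *)
Lemma gradient_of_quadratic_error (g : 'rV[R]_n -> R) (x w : 'rV[R]_n) (C : R) :
  (forall h, `|g (x + h) - g x - dot h w| <= C * dot h h) -> gradient g x = w.
Proof.
move=> g_err; apply/rowP => j; rewrite mxE; apply: cvg_lim => //.
apply/cvgrPdist_le => e e0; near=> h.
have h0 : h != 0 by near: h; exact: nbhs_dnbhs_neq.
have hC : `|h| <= e / (`|C| + 1).
  by near: h; apply: dnbhs0_le; rewrite divr_gt0 // ltr_wpDl.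
have h_gt0 : 0 < `|h| by rewrite normr_gt0.
have := g_err (h *: delta_mx 0 j); rewrite !dot_linear !dot_delta mxE !eqxx mulr1 => gh.
rewrite /= /shift /= (addrC _ x) distrC -(ler_pM2l h_gt0) -normrM.
have -> : h * (h^-1 *: (g (x + h *: delta_mx 0 j) - g x) - w 0 j) =
    g (x + h *: delta_mx 0 j) - g x - h * w 0 j.
  by rewrite /GRing.scale /= mulrBr mulVKf.
apply: (le_trans gh).
rewrite -expr2 -(real_normK (num_real h)) expr2 mulrCA ler_pM2l //.
apply: le_trans (_ : (`|C| + 1) * `|h| <= _).
  apply: ler_wpM2r; first exact: ltW.
  by rewrite (le_trans (ler_norm C)) // lerDl.
by rewrite mulrC -ler_pdivlMr // ltr_wpDl.
Unshelve. all: by end_near. Qed.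

End Calculus.

(** * Minimizers *)

Section Minimizers.
Context {R : realType} {n : nat}.
Implicit Types (f : 'rV[R]_n -> \bar R) (x p : 'rV[R]_n).
Local Open Scope ereal_scope.

Lemma minval_Argmin f p : Argmin f p -> minval f = f p.
Proof.
move=> fp; apply/eqP; rewrite eq_le; apply/andP; split.
  by apply: ereal_inf_lbound; exists p.
by apply/ereal_infP => _ [u _ <-].
Qed.

Lemma crit_Argmin f : crit f = Argmin f.
Proof.
apply/funext => x; apply/propext.
by split=> fx y; move: (fx y); rewrite dot0l adde0.
Qed.

Lemma Argmin_fin_num f p : Defs.proper f -> Argmin f p -> f p \is a fin_num.
Proof.
move=> [fNy [d fd]] fp; rewrite fin_numE fNy lt_eqF //.
exact: le_lt_trans (fp d) fd.
Qed.

End Minimizers.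

(** * The proximal map and the Moreau envelope *)

Section ProximalMap.
Context {R : realType} {n : nat}.
Variables (f : 'rV[R]_n -> \bar R) (lam : R).
Hypotheses (f_Gamma0 : Gamma0 f) (f_min : Argmin f !=set0) (lam_gt0 : 0 < lam).
Implicit Types x y h c u : 'rV[R]_n.

Let q := prox lam f.

Let f_proper : Defs.proper f. Proof. by case: f_Gamma0. Qed.

Let lam2_gt0 : 0 < 2 * lam. Proof. by rewrite mulr_gt0. Qed.

Lemma prox_objE x u :
  prox_obj lam f x u = (f u + (dot (x - u) (x - u) / (2 * lam))%:E)%E.
Proof. by rewrite /prox_obj enorm2. Qed.

(** Outside the box of radius [|x - z|] around [x], for a minimizer [z] of
[f], both summands of the proximal objective are at least their values at [z], so a
minimizer over the compact box is global. *)
Lemma prox_minimizes x : Argmin (prox_obj lam f x) (q x).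
Proof.
apply: xgetPex; have [z fz] := f_min.
pose K := [set u : 'rV[R]_n | forall i,
  `[x 0 i - enorm (x - z), x 0 i + enorm (x - z)]%classic (u ord0 i)].
have KP u : enorm (x - u) <= enorm (x - z) -> K u.
  move=> xu i; have := le_trans (coord_le_enorm (x - u) i) xu.
  by rewrite !mxE /= in_itv /= ler_norml => /andP[? ?]; apply/andP; split; lra.
have [|||p _ pK] := @lsc_attains_min _ R (prox_obj lam f x) K.
- case: f_Gamma0 => _ f_lsc _.
  rewrite (_ : prox_obj lam f x =
    fun u => (f u + (dot (x - u) (x - u) / (2 * lam))%:E)%E); last first.
    by apply/funext => u; exact: prox_objE.
  apply: lscD_continuous f_lsc _ => u.
  have := continuousM (@dot_self_continuous _ _ x u)
    (@cst_continuous _ R (2 * lam)^-1 u).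
  exact.
- have := @rV_compact R n (fun i => `[x 0 i - enorm (x - z), x 0 i + enorm (x - z)]%classic)
    (fun i => @segment_compact _ _ _).
  exact.
- by exists z; exact: KP.
exists p => u; have [Ku|nKu] := pselect (K u); first exact: pK.
apply: le_trans (pK z (KP _ (lexx _))) _; rewrite /prox_obj.
apply: leeD (fz u) _; rewrite lee_fin ler_pM2r ?invr_gt0 //.
rewrite ler_sqr ?nnegrE ?enorm_ge0 // leNgt; apply/negP => /ltW xu.
by apply: nKu; exact: KP.
Qed.

Lemma prox_fin_num x : f (q x) \is a fin_num.
Proof.
have [z fz] := f_min; have fz_fin := Argmin_fin_num _ _ f_proper fz.
rewrite fin_numE (proj1 f_proper) /=; apply/negP => /eqP fq.
have := prox_minimizes x z; rewrite !prox_objE fq addye // -(fineK fz_fin).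
by rewrite -EFinD leye_eq.
Qed.

(** Compare the objective at [q x] and at [t *: y + (1 - t) *: q x]: by
convexity of [f], after division by [t], the subgradient inequality holds up
to [t * |y - q x|^2 / (2 * lam)], and [t] tends to [0]. *)
Lemma prox_subdiff x : subdiff f (q x) (lam^-1 *: (x - q x)).
Proof.
move=> y; have [->|fy] := eqVneq (f y) +oo%E; first exact: leey.
have fy_fin : f y \is a fin_num by rewrite fin_numE (proj1 f_proper) fy.
have fq_fin := prox_fin_num x; have f_cvx : econvex f by case: f_Gamma0.
rewrite -(fineK fy_fin) -(fineK fq_fin) -EFinD lee_fin dotZl.
apply: (@le_of_le_scaled_error _ _ _ (dot (y - q x) (y - q x) / (2 * lam))).
  by rewrite divr_ge0 ?dot_ge0 ?ltW.
move=> t t01; have /andP[t0 t1] := t01.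
have := le_trans (prox_minimizes x (t *: y + (1 - t) *: q x)).
move=> /(_ (t%:E * f y + (1 - t)%:E * f (q x) +
  (dot (x - (t *: y + (1 - t) *: q x)) (x - (t *: y + (1 - t) *: q x))
    / (2 * lam))%:E)%E).
rewrite !prox_objE => /(_ (leeD (f_cvx _ _ _ t01) (lexx _))).
rewrite -(fineK fy_fin) -(fineK fq_fin) -!EFinM -!EFinD lee_fin /=.
have -> : x - (t *: y + (1 - t) *: q x) = (x - q x) - t *: (y - q x).
  by apply/rowP => j; rewrite !mxE; ring.
move: (x - q x) (y - q x) => a b.
rewrite !dot_linear (dotC b a) => obj_le.
rewrite -(ler_pM2l t0).
move: obj_le; set A := fine _; set B := fine _.
set l := (2 * lam)^-1.
have -> : lam^-1 = 2 * l by rewrite /l; field; rewrite gt_eqF.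
rewrite -subr_ge0 => obj_le; rewrite -subr_ge0.
by move: obj_le; congr (_ <= _); ring.
Qed.

Lemma prox_le x y : f y \is a fin_num ->
  fine (f (q x)) + dot (x - q x) (y - q x) / lam <= fine (f y).
Proof.
move=> fy; have := prox_subdiff x y.
by rewrite -(fineK fy) -(fineK (prox_fin_num x)) -EFinD lee_fin dotZl mulrC.
Qed.

(** Firm nonexpansiveness, obtained by adding the subgradient inequality at
[q x] tested with [q y] to the one at [q y] tested with [q x]. *)
Lemma prox_firm x y : 0 <= dot ((x - q x) - (y - q y)) (q x - q y).
Proof.
have := prox_le x (q y) (prox_fin_num y).
have := prox_le y (q x) (prox_fin_num x).
rewrite -(opprB (q x) (q y)); move: (x - q x) (y - q y) (q x - q y) => a b d hy hx.
rewrite dotDl !dotNl; rewrite dotNr in hx.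
rewrite -(pmulr_lge0 _ (_ : 0 < lam^-1)) ?invr_gt0 //; lra.
Qed.

Lemma moreauE x :
  moreau lam f x = fine (f (q x)) + dot (x - q x) (x - q x) / (2 * lam).
Proof.
rewrite /moreau (minval_Argmin _ _ (prox_minimizes x)) prox_objE.
by rewrite -{1}(fineK (prox_fin_num x)) -EFinD.
Qed.

Lemma moreau_le x u : f u \is a fin_num ->
  moreau lam f x <= fine (f u) + dot (x - u) (x - u) / (2 * lam).
Proof.
move=> fu; have := prox_minimizes x u; rewrite !prox_objE moreauE.
by rewrite -(fineK fu) -(fineK (prox_fin_num x)) -!EFinD lee_fin.
Qed.

(** With [v] and [w] the residuals [x - q x] at [x] and at [x + h], each
proximal point is a competitor in the other's problem, so the increment of
the envelope lies between [<h, w> / lam - |h|^2 / (2 lam)] and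
[<h, v> / lam + |h|^2 / (2 lam)]; firm nonexpansiveness gives
[<h, v> <= <h, w>]. *)
Lemma moreau_expansion x h :
  `|moreau lam f (x + h) - moreau lam f x - dot h (lam^-1 *: (x - q x))| <=
  (2 * lam)^-1 * dot h h.
Proof.
have up := moreau_le (x + h) (q x) (prox_fin_num x).
have low := moreau_le x (q (x + h)) (prox_fin_num (x + h)).
have firm := prox_firm (x + h) x.
rewrite !moreauE in up low *; rewrite dotZr.
set v := x - q x in up low firm *; set w := x + h - q (x + h) in up low firm *.
have ev : x + h - q x = v + h by rewrite addrAC.
have ew : x - q (x + h) = w - h by rewrite /w addrAC addrK.
have eqd : q (x + h) - q x = h + v - w.
  by apply/rowP => j; rewrite !mxE; ring.
rewrite ev in up; rewrite ew in low; rewrite eqd in firm.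
clearbody v w.
have wv := dot_ge0 (w - v).
move: up low firm wv; rewrite !dot_linear.
rewrite (dotC v h) (dotC w h) (dotC v w) => up low firm wv.
set l := (2 * lam)^-1 in up low *.
have l0 : 0 < l by rewrite invr_gt0.
have -> : lam^-1 = 2 * l by rewrite /l; field; rewrite gt_eqF.
have hvw : 0 <= l * (dot h w - dot h v) by apply: mulr_ge0; [exact: ltW|lra].
rewrite ler_norml; apply/andP; split; lra.
Qed.

Lemma gradient_moreau x : gradient (moreau lam f) x = lam^-1 *: (x - q x).
Proof. exact: gradient_of_quadratic_error (moreau_expansion x). Qed.

Lemma prox_fixed_Argmin x : q x = x <-> Argmin f x.
Proof.
split=> [qx y|fx].
  by have := prox_subdiff x y; rewrite qx subrr scaler0 dot0l adde0.
have fx_fin := Argmin_fin_num _ _ f_proper fx.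
have : fine (f x) <= fine (f (q x)).
  by rewrite -lee_fin !fineK ?prox_fin_num.
have := prox_le x x fx_fin => h1 h2.
apply/eqP; rewrite eq_sym -subr_eq0; apply/eqP; apply: dot_eq0.
apply/eqP; rewrite eq_le dot_ge0 andbT.
by rewrite -(pmulr_lle0 _ (_ : 0 < lam^-1)) ?invr_gt0 //; lra.
Qed.

Lemma crit_grad_moreau : crit_grad (moreau lam f) = Argmin f.
Proof.
apply/funext => x; apply/propext; rewrite /crit_grad /= gradient_moreau.
rewrite -prox_fixed_Argmin; split=> [/eqP|->]; last by rewrite subrr scaler0.
by rewrite scaler_eq0 invr_eq0 gt_eqF //= subr_eq0 => /eqP.
Qed.

(** The algorithm never leaves the region, so the error bound is available at
every iterate. *)
Lemma prox_sublevel eps x :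
  sublevel_region f eps x -> sublevel_region f eps (q x).
Proof.
move=> [fx _]; split; last by exists (lam^-1 *: (x - q x)); exact: prox_subdiff.
apply: le_trans fx; apply: le_trans (prox_subdiff x x).
by rewrite leeDl // lee_fin dotZl mulr_ge0 ?dot_ge0 // invr_ge0 ltW.
Qed.

Lemma PPA_sublevel eps x k :
  sublevel_region f eps x -> sublevel_region f eps (PPA lam f x k).
Proof. by move=> xO; elim: k => //= k; exact: prox_sublevel. Qed.

Lemma PPA_gradient_step x k :
  PPA lam f x k.+1 = PPA lam f x k - lam *: gradient (moreau lam f) (PPA lam f x k).
Proof.
rewrite gradient_moreau scalerA divff ?gt_eqF // scale1r.
by rewrite opprB addrCA subrr addr0.
Qed.

(** * Growth of the objective and linear convergence *)

Section ErrorBound.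
Variables (alpha : R) (Omega : set 'rV[R]_n).
Hypothesis EB : obj_EB f alpha Omega.

Let alpha_gt0 : 0 < alpha. Proof. by case: EB. Qed.

(** The gap [f (q x) - minval f] lies between the two sides: the growth
condition at [q x] bounds it below, the subgradient inequality tested at [c] above. *)
Lemma prox_dist_le_gap x c : Omega (q x) -> Argmin f c ->
  alpha / 2 * dist_set (q x) (Argmin f) ^+ 2 <= dot (x - q x) (q x - c) / lam.
Proof.
move=> qO fc; have fc_fin := Argmin_fin_num _ _ f_proper fc.
have [_ /(_ (q x))] := EB; rewrite crit_Argmin (minval_Argmin _ _ fc).
have fq_fin := prox_fin_num x => h.
have /h : (Omega `&` Defs.dom f) (q x).
  by split=> //; rewrite /Defs.dom /= -(fineK fq_fin) ltry.
rewrite -(fineK fq_fin) -(fineK fc_fin) -EFinB lee_fin => {}h.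
have := prox_le x c fc_fin.
rewrite -(opprB (q x) c) dotNr; lra.
Qed.

Lemma moreau_cor_EB : (forall x, Omega x -> Omega (q x)) ->
  cor_EB (moreau lam f) (Num.min (alpha / 4) (1 / (4 * lam))) Omega.
Proof.
move=> qO; split; first by rewrite lt_min !divr_gt0 // mulr_gt0.
move=> x xO; rewrite crit_grad_moreau; apply/ereal_infP => _ [p [fp _] <-].
rewrite lee_fin gradient_moreau dotZl.
have gap := prox_dist_le_gap x p (qO _ xO) fp.
have split_ := sqr_dist_set_split x (q x) _ f_min.
have dq0 := sqr_ge0 (dist_set (q x) (Argmin f)).
have xq0 := dot_ge0 (x - q x).
have -> : dot (x - q x) (x - p) = dot (x - q x) (x - q x) + dot (x - q x) (q x - p).
  by rewrite -dotDr addrA subrK.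
set nu := Num.min _ _.
have nu_alpha : nu <= alpha / 4 by rewrite ge_min lexx.
have nu_lam : nu <= lam^-1 / 4.
  by rewrite ge_min; apply/orP; right; rewrite mul1r invfM mulrC.
have nu0 : 0 <= nu by rewrite le_min !divr_ge0 ?ltW // mulr_gt0.
have l0 : 0 < lam^-1 by rewrite invr_gt0.
move: (dist_set x _ ^+ 2) (dist_set (q x) _ ^+ 2) (dot _ (x - q x))
  (dot _ (q x - p)) gap split_ dq0 xq0 => D E X Y gap split_ E0 X0.
have := ler_wpM2l nu0 split_.
have := ler_wpM2r E0 nu_alpha; have := ler_wpM2r X0 nu_lam.
have := mulr_ge0 (ltW l0) X0; lra.
Qed.

Lemma prox_contracts x : Omega (q x) ->
  dist_set (q x) (Argmin f) ^+ 2 <=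
  (1 - Num.min (alpha * lam / 4) (1 / 4)) * dist_set x (Argmin f) ^+ 2.
Proof.
move=> qO.
(* Pythagoras with a favourable cross term, in the limit over [c]. *)
have pyth : dot (x - q x) (x - q x) +
    (1 + lam * alpha) * dist_set (q x) (Argmin f) ^+ 2 <=
    dist_set x (Argmin f) ^+ 2.
  apply: le_sqr_dist_set f_min _ => c fc.
  have := prox_dist_le_gap x c qO fc.
  rewrite ler_pdivlMr // => gap.
  have qc : dist_set (q x) (Argmin f) ^+ 2 <= dot (q x - c) (q x - c).
    by rewrite -enorm2 ler_sqr ?nnegrE ?enorm_ge0 ?dist_set_ge0 ?dist_set_le.
  have -> : x - c = (x - q x) + (q x - c) by rewrite addrA subrK.
  move: (x - q x) (q x - c) gap qc => a b gap qc.
  rewrite dotDl !dotDr (dotC b a); lra.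
have split_ := sqr_dist_set_split x (q x) _ f_min.
have dq0 := sqr_ge0 (dist_set (q x) (Argmin f)).
have xq0 := dot_ge0 (x - q x).
set kap := Num.min _ _.
have kap_alpha : kap <= alpha * lam / 4 by rewrite ge_min lexx.
have kap_4 : kap <= 1 / 4 by rewrite ge_min lexx orbT.
have kap0 : 0 <= kap by rewrite le_min !divr_ge0 ?mulr_ge0 ?ltW.
move: (dist_set x _ ^+ 2) (dist_set (q x) _ ^+ 2) (dot _ _)
  pyth split_ dq0 xq0 => D E X pyth split_ E0 X0.
have := ler_wpM2l kap0 split_.
have := ler_wpM2r E0 kap_alpha; have := ler_wpM2r X0 kap_4.
have := mulr_ge0 (mulr_ge0 (ltW alpha_gt0) (ltW lam_gt0)) E0; lra.
Qed.

End ErrorBound.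

(** A step that contracts the distance must be long, and the objective drops
by at least [|x - q x|^2 / lam] along it. *)
Lemma contraction_obj_growth (tau : R) x : 0 < tau < 1 ->
  dist_set (q x) (Argmin f) ^+ 2 <= tau * dist_set x (Argmin f) ^+ 2 ->
  f x \is a fin_num ->
  (((1 - Num.sqrt tau) ^+ 2 / (2 * lam) / 2 *
    dist_set x (Argmin f) ^+ 2)%:E <= f x - minval f)%E.
Proof.
move=> /andP[tau0 tau1] contr fx_fin; have [z fz] := f_min.
have fz_fin := Argmin_fin_num _ _ f_proper fz.
rewrite (minval_Argmin _ _ fz) -(fineK fx_fin) -(fineK fz_fin) -EFinB lee_fin.
have fzq : fine (f z) <= fine (f (q x)).
  by rewrite -lee_fin !fineK ?prox_fin_num.
have := prox_le x x fx_fin; rewrite -enorm2.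
have := dist_set_triangle x (q x) _ f_min.
have s0 : 0 <= Num.sqrt tau by exact: sqrtr_ge0.
have s1 : Num.sqrt tau < 1 by rewrite -sqrtr1 ltr_sqrt.
have : dist_set (q x) (Argmin f) <= Num.sqrt tau * dist_set x (Argmin f).
  rewrite -ler_sqr ?nnegrE ?mulr_ge0 ?dist_set_ge0 //.
  by rewrite exprMn sqr_sqrtr ?(ltW tau0).
have := dist_set_ge0 x _ f_min; have := enorm_ge0 (x - q x).
move: (dist_set (q x) _) (dist_set x _) (enorm _) (Num.sqrt tau) s0 s1
  => d D e s s0 s1 e0 D0 ds De descent.
have sD : ((1 - s) * D) ^+ 2 <= e ^+ 2.
  rewrite ler_sqr ?nnegrE //; last by apply: mulr_ge0 => //; lra.
  lra.
have l0 : 0 < (2 * lam)^-1 by rewrite invr_gt0.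
have := ler_wpM2l (ltW l0) sD; have := mulr_ge0 (ltW l0) (sqr_ge0 e).
have := mulr_ge0 (ltW l0) (sqr_ge0 ((1 - s) * D)).
rewrite (_ : lam^-1 = 2 * (2 * lam)^-1) in descent; last first.
  by field; rewrite gt_eqF.
rewrite exprMn; lra.
Qed.

End ProximalMap.

Theorem corollary6 (R : realType) (n : nat) (f : 'rV[R]_n -> \bar R)
    (lam eps : R) (Omega : set 'rV[R]_n)
    (f_Gamma0 : Gamma0 f) (f_min : Argmin f !=set0)
    (lam_gt0 : 0 < lam) (eps_gt0 : 0 < eps)
    (Omega_def : Omega = sublevel_region f eps) :
  [/\ (forall x0, Omega x0 -> forall k,
        PPA lam f x0 k.+1 =
        PPA lam f x0 k - lam *: gradient (moreau lam f) (PPA lam f x0 k)),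
      (forall alpha : R, obj_EB f alpha Omega ->
        cor_EB (moreau lam f) (Num.min (alpha / 4) (1 / (4 * lam))) Omega /\
        (forall x0, Omega x0 -> forall k,
          dist_set (PPA lam f x0 k.+1) (Argmin f) ^+ 2 <=
          (1 - Num.min (alpha * lam / 4) (1 / 4)) *
            dist_set (PPA lam f x0 k) (Argmin f) ^+ 2))
    & (forall tau : R, 0 < tau < 1 ->
        (forall x0, Omega x0 -> forall k,
          dist_set (PPA lam f x0 k.+1) (Argmin f) ^+ 2 <=
          tau * dist_set (PPA lam f x0 k) (Argmin f) ^+ 2) ->
        obj_EB f ((1 - Num.sqrt tau) ^+ 2 / (2 * lam)) Omega)].
Proof.
subst Omega; have prox_Omega x := @prox_sublevel _ _ f lam f_Gamma0 f_min lam_gt0 eps x.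
split.
- by move=> x0 _ k; exact: PPA_gradient_step.
- move=> alpha EB; split; first exact: moreau_cor_EB.
  move=> x0 x0O k; apply: (@prox_contracts _ _ f lam f_Gamma0 f_min lam_gt0 alpha _ EB).
  by apply: prox_Omega; exact: PPA_sublevel.
- move=> tau tau01 PPA_linear; have /andP[tau0 tau1] := tau01; split.
    rewrite divr_gt0 ?exprn_gt0 ?mulr_gt0 // subr_gt0.
    by rewrite -sqrtr1 ltr_sqrt.
  move=> x [xO fx]; rewrite crit_Argmin.
  apply: contraction_obj_growth => //; first exact: (PPA_linear x xO 0%N).
  by case: f_Gamma0 => -[fNy _] _ _; rewrite fin_numE fNy lt_eqF.
Qed.
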